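(* Let $\Delta$ be a simplicial complex on a finite set $V$ which is not a simplex. Then $$\operatorname{im}(B(\Delta))=\max\{2,\nu(\Delta),\mathfrak{h}(\Delta)\}.$$
   Context: A simplicial complex $\Delta$ on a finite set $V$ is a family of subsets of $V$, closed under taking subsets, with $\{v\}\in\Delta$ for all $v\in V$. $\mathcal{F}_\Delta$ denotes the set of facets (maximal faces). $\Delta$ is a simplex if $V\in\Delta$. The bipartite graph $B(\Delta)$ has vertex set $V\cup\mathcal{F}_\Delta$ (disjoint union), with $s\in V$ adjacent to $F\in\mathcal{F}_\Delta$ if and only if $s\notin F$. For a graph $G$, $\operatorname{im}(G)$ is the maximum cardinality of an induced matching, i.e. of a matching $M$ such that the subgraph of $G$ induced on the vertices covered by $M$ has no edges other than those of $M$. For an integer $m\ge 3$, an $m$-flower of $\Delta$ is a set $\{(x_1,F_1),\ldots,(x_m,F_m)\}$ of pairs $(x_i,F_i)\in V\times\mathcal{F}_\Delta$ such that $\{x_1,\ldots,x_m\}$ is a face of $\Delta$, and $x_i\notin F_j$ if and only if $i=j$. The flower number $\nu(\Delta)$ is the largest $k\ge 3$ such that $\Delta$ has a $k$-flower, and $\nu(\Delta)=0$ if $\Delta$ has no $k$-flower for any $k\geq 3$. A minimal non-face of $\Delta$ is a subset $K\subseteq V$ with $K\notin\Delta$ all of whose proper subsets are in $\Delta$. The Helly number $\mathfrak{h}(\Delta)$ is the maximum size of a minimal non-face of $\Delta$. *)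

(* Defs.v *)
From mathcomp Require Import all_boot.

Set Implicit Arguments.
Unset Strict Implicit.
Unset Printing Implicit Defensive.

Record sgraph := SGraph {
  vertex : finType;
  adj : rel vertex;
  adj_sym : symmetric adj;
  adj_irrefl : irreflexive adj
}.

Section InducedMatching.

Variable G : sgraph.

Definition edges : {set {set vertex G}} :=
  [set [set p.1; p.2] | p : vertex G * vertex G & adj p.1 p.2].

(* Edges are nonempty, so [trivIset M] says exactly that distinct edges of [M]
   share no vertex. *)
Definition matching (M : {set {set vertex G}}) : bool :=
  (M \subset edges) && trivIset M.

Definition induced_matching (M : {set {set vertex G}}) : bool :=
  matching M &&
  [forall E in edges, (E \subset cover M) ==> (E \in M)].

Definition im : nat :=
  \max_(M : {set {set vertex G}} | induced_matching M) #|M|.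

End InducedMatching.

Section Complex.

Variable V : finType.

(* The ground set is the whole type [V].  The condition [set0 \in D] excludes
   only the void family on an empty [V]: otherwise it follows from the other
   two conditions. *)
Definition simplicial_complex (D : {set {set V}}) : Prop :=
  [/\ set0 \in D,
      forall A B : {set V}, A \subset B -> B \in D -> A \in D
    & forall v : V, [set v] \in D].

Variable D : {set {set V}}.

Definition is_simplex : bool := [set: V] \in D.

Definition facets : {set {set V}} :=
  [set F : {set V} | maxset [pred A : {set V} | A \in D] F].

Definition Bvertex : finType := (V + {F : {set V} | F \in facets})%type.

Definition Badj (u v : Bvertex) : bool :=
  match u, v with
  | inl s, inr F => s \notin val F
  | inr F, inl s => s \notin val F
  | _, _ => false
  end.

Lemma Badj_sym : symmetric Badj.
Proof. by case=> [s|F] []. Qed.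

Lemma Badj_irrefl : irreflexive Badj.
Proof. by case. Qed.

Definition B : sgraph := SGraph Badj_sym Badj_irrefl.

(* In an indexed family (x_i, F_i) with x_i \notin F_j iff i = j the pairs are
   pairwise distinct, so the pairs themselves serve as indices. *)
Definition is_flower (m : nat) (S : {set V * {set V}}) : bool :=
  [&& 3 <= m,
      #|S| == m,
      [forall p in S, p.2 \in facets],
      [set p.1 | p in S] \in D
    & [forall p in S, forall q in S, (p.1 \notin q.2) == (p == q)]].

Definition flower_number : nat :=
  \max_(S : {set V * {set V}} | is_flower #|S| S) #|S|.

Definition minimal_nonface (K : {set V}) : bool :=
  (K \notin D) && [forall L : {set V}, (L \proper K) ==> (L \in D)].

Definition helly_number : nat :=
  \max_(K : {set V} | minimal_nonface K) #|K|.

End Complex.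

(* Main.v *)
Require Import Defs.
From mathcomp Require Import all_boot.

(** Edges of [B Delta] all join a vertex [x] to a facet [F] with [x \notin F],
    so an induced matching with [k] edges amounts to vertices [x_1, ..., x_k]
    and facets [F_1, ..., F_k] such that [x_i \notin F_j] exactly when [i = j]
    ([cross_family_le_im], [induced_matching_cross_family]).  Put
    [X = {x_1, ..., x_k}].

    If [X] is a face then, as soon as [3 <= k], the pairs [(x_i, F_i)] form a
    flower.  If [X] is not a face it is a minimal non-face, because a subset
    of [X] that omits [x_i] lies in the face [F_i].  Hence [k] is at most
    [2], the flower number or the Helly number ([cross_family_le_max]).

    Conversely a flower is such a family, and so is a minimal non-face [K]
    once each [K :\ x] is extended to a facet [F_x]: the facet cannot contain
    [x], as it would then contain [K].  Finally [2] is attained because a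
    complex that is not a simplex has a minimal non-face, whose size is at
    least [2] since the empty set and the singletons are faces. *)

Set Implicit Arguments.
Unset Strict Implicit.
Unset Printing Implicit Defensive.

Section CrossFamilies.

Variables (V : finType) (D : {set {set V}}).

Definition facet : finType := {F : {set V} | F \in facets D}.

Lemma facet_face (F : facet) : val F \in D.
Proof. by have := valP F; rewrite inE => /maxsetp. Qed.

Lemma face_sub_facet (A : {set V}) :
  A \in D -> exists F : facet, A \subset val F.
Proof.
move=> AD; have [F maxF sAF] := @maxset_exists _ [pred A in D] A AD.
have facetF : F \in facets D by rewrite inE.
by exists (exist _ F facetF).
Qed.

(** Indexing by an arbitrary finite type lets the elements of a flower, the
    vertices of a minimal non-face and the edges of an induced matching serve
    as indices directly. *)
Definition cross_family (I : finType) (x : I -> V) (F : I -> facet) : Prop :=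
  forall i j, (x i \notin val (F j)) = (i == j).

Section Family.

Variables (I : finType) (x : I -> V) (F : I -> facet).
Hypothesis xF : cross_family x F.

Lemma cross_family_injl : injective x.
Proof. by move=> i j eq_x; apply/eqP; rewrite -xF eq_x xF. Qed.

Lemma cross_family_injr : injective F.
Proof. by move=> i j eq_F; apply/eqP; rewrite -xF -eq_F xF. Qed.

Definition cross_edge (i : I) : {set vertex (B D)} :=
  [set inl (x i); inr (F i)].

Lemma mem_cross_edgel i s : (inl s \in cross_edge i) = (s == x i).
Proof. by rewrite !inE orbF. Qed.

Lemma mem_cross_edger i G : (inr G \in cross_edge i) = (G == F i).
Proof. by rewrite !inE. Qed.

Lemma cross_edge_inj : injective cross_edge.
Proof.
move=> i j eq_e; apply: cross_family_injl; apply/eqP.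
by rewrite -mem_cross_edgel -eq_e mem_cross_edgel.
Qed.

Lemma cross_edges_matching : matching [set cross_edge i | i : I].
Proof.
apply/andP; split.
  apply/subsetP => _ /imsetP[i _ ->]; apply/imsetP.
  by exists (inl (x i), inr (F i)); rewrite // inE /= xF.
apply/trivIsetP => _ _ /imsetP[i _ ->] /imsetP[j _ ->] ne_e.
rewrite -setI_eq0; apply: contraNT ne_e => /set0Pn[[s|G]].
  rewrite in_setI !mem_cross_edgel => /andP[/eqP-> /eqP].
  by move=> /cross_family_injl ->.
rewrite in_setI !mem_cross_edger => /andP[/eqP-> /eqP].
by move=> /cross_family_injr ->.
Qed.

(** An edge between covered vertices joins some [x i] to some [F j] with
    [x i \notin F j], which forces [i = j]: the matching is induced. *)
Lemma cross_edges_induced : induced_matching [set cross_edge i | i : I].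
Proof.
apply/andP; split; first exact: cross_edges_matching.
have cross s G : inl s \in cover [set cross_edge i | i : I] ->
    inr G \in cover [set cross_edge i | i : I] -> s \notin val G ->
    [set inl s; inr G] \in [set cross_edge i | i : I].
  move=> /bigcupP[_ /imsetP[i _ ->]]; rewrite mem_cross_edgel => /eqP->.
  move=> /bigcupP[_ /imsetP[j _ ->]]; rewrite mem_cross_edger => /eqP->.
  by rewrite xF => /eqP->; apply: imset_f.
apply/forall_inP => E /imsetP[[[s|G] [t|H]]]; rewrite inE //= => sG ->;
  apply/implyP; rewrite subUset !sub1set => /andP[cov1 cov2].
  exact: cross.
by rewrite setUC; apply: cross.
Qed.

Lemma cross_family_le_im : #|I| <= im (B D).
Proof.
rewrite -(card_imset predT cross_edge_inj).
exact: (leq_bigmax_cond _ cross_edges_induced).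
Qed.

Lemma cross_family_flower :
  2 < #|I| -> [set x i | i : I] \in D -> #|I| <= flower_number D.
Proof.
move=> I_gt2 XD; pose pair i := (x i, val (F i)).
have pair_inj : injective pair by move=> i j [/cross_family_injl].
have cardS : #|[set pair i | i : I]| = #|I| by rewrite card_imset.
have flowerS : is_flower D #|[set pair i | i : I]| [set pair i | i : I].
  apply/and5P; split; rewrite ?cardS //.
  - by apply/forall_inP => _ /imsetP[i _ ->]; apply: valP.
  - by rewrite -imset_comp.
  - apply/forall_inP => _ /imsetP[i _ ->].
    apply/forall_inP => _ /imsetP[j _ ->].
    by rewrite xF (inj_eq pair_inj).
by apply: (bigmax_sup [set pair i | i : I]) => //; rewrite cardS.
Qed.

Hypothesis D_complex : simplicial_complex D.

(** A proper subset of the range of [x] omits some [x i], and every other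
    [x j] lies in [F i]. *)
Lemma cross_family_minimal_nonface :
  [set x i | i : I] \notin D -> minimal_nonface D [set x i | i : I].
Proof.
move=> XND; apply/andP; split=> //; apply/forall_inP => L.
case/properP => sLX [_ /imsetP[i _ ->] xiNL].
have [_ D_down _] := D_complex; apply: D_down (facet_face (F i)).
apply/subsetP => y yL; have /imsetP[j _ def_y] := subsetP sLX y yL.
rewrite def_y -[_ \in _]negbK xF; apply: contraNN xiNL => /eqP<-.
by rewrite -def_y.
Qed.

Lemma cross_family_le_max :
  #|I| <= maxn 2 (maxn (flower_number D) (helly_number D)).
Proof.
rewrite !leq_max; have [//|I_gt2] := leqP #|I| 2.
have [XD | XND] := boolP ([set x i | i : I] \in D).
  by rewrite cross_family_flower.
rewrite -(card_imset predT cross_family_injl).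
apply/orP; right; apply/orP; right.
apply: (bigmax_sup [set x i | i : I]) => //.
exact: cross_family_minimal_nonface.
Qed.

End Family.

Lemma edges_BP (E : {set vertex (B D)}) :
  reflect (exists s : V, exists2 G : facet, s \notin val G
             & E = [set inl s; inr G])
          (E \in edges (B D)).
Proof.
apply: (iffP imsetP) => [[[[s|G] [t|H]]] | [s [G sG ->]]].
- by rewrite inE.
- by rewrite inE /= => sH ->; exists s; exists H.
- by rewrite inE /= => tG ->; exists t; exists G; rewrite // setUC.
- by rewrite inE.
- by exists (inl s, inr G); rewrite ?inE.
Qed.

(** Each edge of [M] is labelled by its own two endpoints.  Were [x E1] joined
    to [F E2] for distinct [E1] and [E2], that edge would violate inducedness. *)
Lemma induced_matching_cross_family (M : {set {set vertex (B D)}}) :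
  induced_matching M ->
  exists x : {E | E \in M} -> V, exists F : {E | E \in M} -> facet,
    cross_family x F.
Proof.
case/andP => /andP[/subsetP sME trivM] /forall_inP indM.
have endpoints (E : {E | E \in M}) : {p : V * facet |
    (p.1 \notin val p.2) && (val E == [set inl p.1; inr p.2])}.
  apply: sigW; have /edges_BP[s [G sG ->]] := sME _ (valP E).
  by exists (s, G); rewrite sG /=.
pose x E := (val (endpoints E)).1; pose F E := (val (endpoints E)).2.
have xFE E : x E \notin val (F E) by have /andP[] := valP (endpoints E).
have EE E : val E = [set inl (x E); inr (F E)].
  by have /andP[_ /eqP] := valP (endpoints E).
have mem_x E : inl (x E) \in val E by rewrite EE set21.
have mem_F E : inr (F E) \in val E by rewrite EE set22.
exists x, F => E1 E2; apply/idP/eqP => [xF12 | ->]; last exact: xFE.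
(* The edge from [x E1] to [F E2] meets both [E1] and [E2], and it belongs to
   [M], whose members are pairwise disjoint. *)
pose E0 : {set vertex (B D)} := [set inl (x E1); inr (F E2)].
have E0M : E0 \in M.
  have E0e : E0 \in edges (B D).
    by apply/edges_BP; exists (x E1); exists (F E2).
  apply: (implyP (indM _ E0e)); rewrite subUset !sub1set.
  apply/andP; split; apply/bigcupP; first by exists (val E1); rewrite ?(valP E1).
  by exists (val E2); rewrite ?(valP E2).
apply: val_inj.
rewrite -(def_pblock trivM (valP E1) (mem_x E1)).
rewrite (def_pblock trivM E0M (set21 _ _)).
by rewrite -(def_pblock trivM (valP E2) (mem_F E2))
  (def_pblock trivM E0M (set22 _ _)).
Qed.

Lemma flower_le_im (S : {set V * {set V}}) :
  is_flower D #|S| S -> #|S| <= im (B D).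
Proof.
case/and5P => _ _ /forall_inP facetS _ /forall_inP crossS.
pose x (p : {p | p \in S}) := (val p).1.
pose F (p : {p | p \in S}) : facet := exist _ (val p).2 (facetS _ (valP p)).
have xF : cross_family x F.
  by move=> p q; have /forall_inP/(_ _ (valP q))/eqP := crossS _ (valP p).
by have := cross_family_le_im xF; rewrite card_sig.
Qed.

Hypothesis D_complex : simplicial_complex D.

(** Minimality makes [K :\ v] a face, hence contained in a facet [F v], and
    [F v] misses [v] because otherwise it would contain the non-face [K]. *)
Lemma minimal_nonface_le_im (K : {set V}) :
  minimal_nonface D K -> #|K| <= im (B D).
Proof.
case: D_complex => _ D_down _ /andP[KND /forall_inP K_min].
have extend (v : {v | v \in K}) : {F : facet | K :\ val v \subset val F}.
  apply: sigW; apply: face_sub_facet; apply: K_min.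
  exact: properD1 (valP v).
pose x (v : {v | v \in K}) := val v; pose F v := val (extend v).
have xF : cross_family x F.
  move=> u v; have sKF := valP (extend v).
  apply/idP/eqP => [uNF | ->].
    apply: val_inj; apply/eqP; apply: contraNT uNF => ne_uv.
    by apply: (subsetP sKF); rewrite !inE ne_uv (valP u).
  apply: contraNN KND => vF; apply: D_down (facet_face (F v)).
  by rewrite -(setD1K (valP v)) subUset sub1set vF.
by have := cross_family_le_im xF; rewrite card_sig.
Qed.

Lemma minimal_nonface_exists :
  ~~ is_simplex D -> exists K, minimal_nonface D K.
Proof.
move=> TND; have [K /minsetP[KND K_min] _] :=
  @minset_exists _ [pred A | A \notin D] [set: V] TND.
exists K; rewrite /minimal_nonface; apply/andP; split=> //.
apply/forall_inP => L ltLK; apply/negPn/negP => LND.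
by move: (ltLK); rewrite (K_min L LND (proper_sub ltLK)) properxx.
Qed.

Lemma minimal_nonface_gt1 (K : {set V}) : minimal_nonface D K -> 1 < #|K|.
Proof.
case: D_complex => D0 _ D1 /andP[KND _]; rewrite ltnNge.
apply: contraNN KND; rewrite leq_eqVlt ltnS leqn0 cards_eq0.
by case/orP => [/cards1P[v ->] | /eqP->].
Qed.

End CrossFamilies.

Theorem corollary3p10 (V : finType) (Delta : {set {set V}})
    (hDelta : simplicial_complex Delta) (hns : ~~ is_simplex Delta) :
  im (B Delta) = maxn 2 (maxn (flower_number Delta) (helly_number Delta)).
Proof.
apply/eqP; rewrite eqn_leq; apply/andP; split.
  apply/bigmax_leqP => M /induced_matching_cross_family[x [F xF]].
  by have := cross_family_le_max xF hDelta; rewrite card_sig.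
rewrite !geq_max; apply/and3P; split.
- have [K minK] := minimal_nonface_exists hns.
  apply: leq_trans (minimal_nonface_gt1 hDelta minK) _.
  exact: minimal_nonface_le_im hDelta _ minK.
- by apply/bigmax_leqP => S; apply: flower_le_im.
- by apply/bigmax_leqP => K; apply: minimal_nonface_le_im.
Qed.
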